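(* Let $L:\mathbb{T}^d\times\mathbb{R}^d\to\mathbb{R}$ be continuous with $\lim_{|v|\to\infty}\inf_{x\in\mathbb{T}^d}L(x,v)/|v|=+\infty$, and let $(\varphi,\overline{H})$ be a viscosity solution to $H(x,-\nabla\varphi)=\overline{H}$. Then for every $r>0$, $T_r^+\varphi=\varphi-r\overline{H}$. Moreover, given $\varepsilon>0$, there exists $\varkappa_0>0$ such that for all $\varkappa\in(0,\varkappa_0]$, $r>0$ and $y\in\mathbb{T}^d$, \[\limsup_{d(\Delta)\downarrow0}\Big[\varphi(x_{y,\varkappa,r,\Delta}(r))+\int_0^rL(x_{y,\varkappa,r,\Delta}(t),v_{y,\varkappa,r,\Delta}(t))\,dt\Big]\le\varphi(y)-\overline{H}r+(r+1)\varepsilon,\] the limsup being over partitions $\Delta$ of $[0,r]$ with fineness tending to $0$.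
   Context: $\mathbb{T}^d=\mathbb{R}^d/\mathbb{Z}^d$; $x+v$ is the translate of $x\in\mathbb{T}^d$ by $v\in\mathbb{R}^d$. $H(x,p)=\max_{v\in\mathbb{R}^d}[pv-L(x,v)]$. Hadamard sub/superdifferentials: $p\in\partial_D^\mp\varphi(x)$ iff for all $w$, $\liminf_{h\downarrow0,w'\to w}\frac{\varphi(x+hw')-\varphi(x)}{h}\ge pw$ (resp. $\limsup\ldots\le pw$). $(\varphi,\overline{H})$, $\varphi$ continuous, $\overline{H}\in\mathbb{R}$, is a viscosity solution if $H(x,-p)\le\overline{H}$ for all $p\in\partial_D^+\varphi(x)$ and $H(x,-p)\ge\overline{H}$ for all $p\in\partial_D^-\varphi(x)$, for all $x$. A controlled process on $[0,r]$ is $(x(\cdot),v(\cdot))$ with $v\in L^1([0,r];\mathbb{R}^d)$, $x\in C([0,r];\mathbb{T}^d)$, $x(s)=x(0)+\int_0^sv\,dt$. Lax–Oleinik: $T_r^+\phi(y)=\inf\{\phi(x(r))+\int_0^rL(x(t),v(t))dt:(x,v)$ controlled process on $[0,r]$, $x(0)=y\}$. Feedback: $\varphi_\varkappa(x)=\inf_v\{\varphi(x+v)+\frac{1}{2\varkappa^2}|v|^2\}$; $b_\varkappa[x]$ a chosen minimizer, $p_\varkappa[x]=\frac1{\varkappa^2}(-b_\varkappa[x])^\top$, $\mathbbm{v}_\varkappa[x]\in\operatorname{Argmax}_v[-p_\varkappa[x]v-L(x+b_\varkappa[x],v)]$. For a partition $\Delta=\{t_i\}_{i=0}^n$ of $[0,r]$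 with fineness $d(\Delta)=\max_i(t_{i+1}-t_i)$: $x_{y,\varkappa,r,\Delta}(0)=y$, and on $[t_i,t_{i+1})$, $v_{y,\varkappa,r,\Delta}(t)=\mathbbm{v}_\varkappa[x_{y,\varkappa,r,\Delta}(t_i)]$, $x_{y,\varkappa,r,\Delta}(t)=x_{y,\varkappa,r,\Delta}(t_i)+(t-t_i)\mathbbm{v}_\varkappa[x_{y,\varkappa,r,\Delta}(t_i)]$. *)

(* Defs.v *)
From HB Require Import structures.
From mathcomp Require Import all_boot all_order all_algebra.
From mathcomp Require Import all_classical all_reals all_analysis.
Set Implicit Arguments. Unset Strict Implicit. Unset Printing Implicit Defensive.
Import Order.TTheory GRing.Theory Num.Theory numFieldNormedType.Exports.
Local Open Scope classical_set_scope.
Local Open Scope ring_scope.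

Section Defs.
Variables (R : realType) (d : nat).
Local Notation V := 'rV[R]_d.

Definition dotp (p v : V) : R := \sum_(i < d) p ord0 i * v ord0 i.
Definition enorm2 (v : V) : R := \sum_(i < d) v ord0 i ^+ 2.
Definition enorm (v : V) : R := Num.sqrt (enorm2 v).

(** Integer translations: the torus T^d = R^d / Z^d is modelled through
    Z^d-periodic functions on R^d (their lifts). *)
Definition intvec (k : 'rV[int]_d) : V := map_mx (fun z : int => z%:~R) k.
Definition Zperiodic {T : Type} (f : V -> T) : Prop :=
  forall (x : V) (k : 'rV[int]_d), f (x + intvec k) = f x.

Definition Ham (L : V -> V -> R) (x p : V) : \bar R :=
  ereal_sup [set (dotp p v - L x v)%:E | v in [set: V]].

(** Hadamard sub/superdifferentials (liminf / limsup over h -> 0+, w' -> w,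
    unfolded in epsilon-delta form). *)
Definition hsubdiff (phi : V -> R) (x p : V) : Prop :=
  forall w : V, forall e : R, 0 < e -> exists2 del : R, 0 < del &
    forall (h : R) (w' : V), 0 < h -> h < del -> enorm (w' - w) < del ->
      dotp p w - e <= (phi (x + h *: w') - phi x) / h.
Definition hsuperdiff (phi : V -> R) (x p : V) : Prop :=
  forall w : V, forall e : R, 0 < e -> exists2 del : R, 0 < del &
    forall (h : R) (w' : V), 0 < h -> h < del -> enorm (w' - w) < del ->
      (phi (x + h *: w') - phi x) / h <= dotp p w + e.

Definition viscosity_solution (L : V -> V -> R) (phi : V -> R) (Hbar : R) :=
  [/\ continuous phi, Zperiodic phi,
      (forall x p, hsuperdiff phi x p -> Ham L x (- p) <= Hbar%:E)%E &
      (forall x p, hsubdiff phi x p -> Hbar%:E <= Ham L x (- p))%E].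

Definition vintegral (D : set R) (v : R -> V) : V :=
  \row_(i < d) Rintegral lebesgue_measure D (fun t => v t ord0 i).

Definition controlled_process (r : R) (x v : R -> V) : Prop :=
  (forall i : 'I_d,
     lebesgue_measure.-integrable `[0, r] (fun t => (v t ord0 i)%:E)) /\
  (forall s, 0 <= s <= r -> x s = x 0 + vintegral `[0, s] v).

Definition action (L : V -> V -> R) (r : R) (x v : R -> V) : \bar R :=
  (\int[lebesgue_measure]_(t in `[0%R, r]) (L (x t) (v t))%:E)%E.

Definition LaxOleinik (L : V -> V -> R) (r : R) (phi : V -> R) (y : V) : \bar R :=
  ereal_inf [set adde (phi (xv.1 r))%:E (action L r xv.1 xv.2)
            | xv in [set xv : (R -> V) * (R -> V) |
                       controlled_process r xv.1 xv.2 /\ xv.1 0 = y]].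

Definition is_partition (r : R) (ts : seq R) : Prop :=
  [/\ (1 < size ts)%N, head 0 ts = 0, last 0 ts = r & sorted <%R ts].
Definition fineness (ts : seq R) : R :=
  foldr Num.max 0 (pairmap (fun a b => b - a) (head 0 ts) (behead ts)).

Fixpoint pw_traj (F : V -> V) (y : V) (t0 : R) (rest : seq R) (t : R) : V :=
  match rest with
  | [::] => y
  | t1 :: rest' =>
      if t < t1 then y + (t - t0) *: F y
      else pw_traj F (y + (t1 - t0) *: F y) t1 rest' t
  end.
Fixpoint pw_ctrl (F : V -> V) (y : V) (t0 : R) (rest : seq R) (t : R) : V :=
  match rest with
  | [::] => F y
  | t1 :: rest' =>
      if t < t1 then F y
      else pw_ctrl F (y + (t1 - t0) *: F y) t1 rest' t
  end.
Definition traj (F : V -> V) (y : V) (ts : seq R) : R -> V :=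
  pw_traj F y (head 0 ts) (behead ts).
Definition ctrl (F : V -> V) (y : V) (ts : seq R) : R -> V :=
  pw_ctrl F y (head 0 ts) (behead ts).

Definition limsup_fineness (r : R) (J : seq R -> \bar R) : \bar R :=
  ereal_inf [set ereal_sup [set J ts | ts in
                 [set ts | is_partition r ts /\ fineness ts < del]]
            | del in [set del : R | 0 < del]].

Definition scheme_cost (L : V -> V -> R) (phi : V -> R) (F : V -> V)
  (r : R) (y : V) (ts : seq R) : \bar R :=
  adde (phi (traj F y ts r))%:E (action L r (traj F y ts) (ctrl F y ts)).

Definition pfeed (b : R -> V -> V) (kappa : R) (x : V) : V :=
  kappa ^- 2 *: (- b kappa x).
Definition is_min_selection (phi : V -> R) (b : R -> V -> V) : Prop :=
  forall kappa, 0 < kappa -> forall x v : V,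
    phi (x + b kappa x) + enorm2 (b kappa x) / (2 * kappa ^+ 2)
    <= phi (x + v) + enorm2 v / (2 * kappa ^+ 2).
Definition is_argmax_selection (L : V -> V -> R) (b vv : R -> V -> V) : Prop :=
  forall kappa, 0 < kappa -> forall x w : V,
    dotp (- pfeed b kappa x) w - L (x + b kappa x) w
    <= dotp (- pfeed b kappa x) (vv kappa x) - L (x + b kappa x) (vv kappa x).

End Defs.

(* Main.v *)
Require Import Defs.
From HB Require Import structures.
From mathcomp Require Import all_boot all_order all_algebra.
From mathcomp Require Import all_classical all_reals all_analysis.
From mathcomp Require Import measurable_realfun ring lra.
Import Order.TTheory GRing.Theory Num.Theory numFieldNormedType.Exports.
Local Open Scope classical_set_scope.
Local Open Scope ring_scope.
Set Implicit Arguments.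
Unset Strict Implicit.
Unset Printing Implicit Defensive.

(** The inf-convolution [m x = min_v (psi (x + v) + c |v|^2)], with minimizer
    [b x] and [g x = - 2 c b x], satisfies the one-sided expansion
    [m (x + w) <= m x + g x . w + c |w|^2], while [g x] is a subgradient of [psi]
    at [x + b x].  It is used with both [psi = phi] and [psi = - phi].

    For [psi = - phi] the subsolution inequality bounds the gradients [g x] by a
    constant independent of [c], so [m] is Lipschitz uniformly in [c] and, letting
    [c] tend to infinity, so is [phi].  Summing the expansion along a controlled
    process gives [phi (x 0) - r Hbar <= phi (x r) + action].

    For [psi = phi] and [c = 1 / (2 kappa^2)], the supersolution inequality and
    the choice of the feedback as a maximizer make each step of the scheme decrease
    [m] by at least its running cost plus [Hbar] times its length, up to an error
    of second order in the length.  The Lipschitz bound keeps the feedback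
    velocities bounded uniformly in [kappa], which controls all the errors and
    yields the estimate of the scheme; the scheme being itself a controlled
    process, this is also the upper bound on the Lax-Oleinik value. *)

(** * The Euclidean inner product and norm, compared with the sup norm *)

Section Euclid.
Variables (R : realType) (d : nat).
Local Notation V := 'rV[R]_d.
Implicit Types (p v w : V) (a : R).

Lemma dotpC p v : dotp p v = dotp v p.
Proof. by apply: eq_bigr => i _; rewrite mulrC. Qed.

Lemma dotpDr p v w : dotp p (v + w) = dotp p v + dotp p w.
Proof. by rewrite -big_split; apply: eq_bigr => i _; rewrite mxE mulrDr. Qed.

Lemma dotpZr p a v : dotp p (a *: v) = a * dotp p v.
Proof. by rewrite mulr_sumr; apply: eq_bigr => i _; rewrite mxE mulrCA. Qed.

Lemma dotpNr p v : dotp p (- v) = - dotp p v.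
Proof. by rewrite -scaleN1r dotpZr mulN1r. Qed.

Lemma dotpDl p v w : dotp (v + w) p = dotp v p + dotp w p.
Proof. by rewrite dotpC dotpDr !(dotpC p). Qed.

Lemma dotpZl p a v : dotp (a *: v) p = a * dotp v p.
Proof. by rewrite dotpC dotpZr dotpC. Qed.

Lemma dotpNl p v : dotp (- v) p = - dotp v p.
Proof. by rewrite dotpC dotpNr dotpC. Qed.

Lemma enorm2E v : enorm2 v = dotp v v.
Proof. by apply: eq_bigr => i _; rewrite expr2. Qed.

Lemma enorm2_ge0 v : 0 <= enorm2 v.
Proof. by apply: sumr_ge0 => i _; exact: sqr_ge0. Qed.

Lemma enorm2D v w : enorm2 (v + w) = enorm2 v + 2 * dotp v w + enorm2 w.
Proof. rewrite !enorm2E !dotpDl !dotpDr (dotpC w v); ring. Qed.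

Lemma enorm2Z a v : enorm2 (a *: v) = a ^+ 2 * enorm2 v.
Proof. by rewrite !enorm2E dotpZl dotpZr mulrA expr2. Qed.

Lemma enorm2N v : enorm2 (- v) = enorm2 v.
Proof. by rewrite -scaleN1r enorm2Z sqrrN expr1n mul1r. Qed.

Lemma enorm20 : enorm2 (0 : V) = 0.
Proof. by rewrite -(scale0r (0 : V)) enorm2Z expr0n mul0r. Qed.

Lemma sqr_enorm v : enorm v ^+ 2 = enorm2 v.
Proof. by rewrite sqr_sqrtr// enorm2_ge0. Qed.

Lemma enorm_ge0 v : 0 <= enorm v.
Proof. exact: sqrtr_ge0. Qed.

Lemma enormZ a v : enorm (a *: v) = `|a| * enorm v.
Proof. by rewrite /enorm enorm2Z sqrtrM ?sqr_ge0// sqrtr_sqr. Qed.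

Lemma enormN v : enorm (- v) = enorm v.
Proof. by rewrite -scaleN1r enormZ normrN1 mul1r. Qed.

Lemma enorm0 : enorm (0 : V) = 0.
Proof. by rewrite /enorm enorm20 sqrtr0. Qed.

Lemma enorm_eq0 v : enorm v = 0 -> v = 0.
Proof.
move=> v0; have : enorm2 v = 0 by rewrite -sqr_enorm v0 expr0n.
move=> /eqP; rewrite psumr_eq0 => [/allP v00|i _]; last exact: sqr_ge0.
apply/rowP => i; rewrite mxE; apply/eqP; rewrite -sqrf_eq0.
by apply: v00; rewrite mem_index_enum.
Qed.

(** Cauchy-Schwarz: expand [0 <= enorm2 (enorm v *: p - enorm p *: v)] and cancel the product of the
    norms, the zero cases being split off first. *)
Lemma dotp_le p v : dotp p v <= enorm p * enorm v.
Proof.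
have [/enorm_eq0 ->|p0] := eqVneq (enorm p) 0.
  by rewrite enorm0 mul0r -(scale0r (0 : V)) dotpZl mul0r.
have [/enorm_eq0 ->|v0] := eqVneq (enorm v) 0.
  by rewrite enorm0 mulr0 -(scale0r (0 : V)) dotpZr mul0r.
have pp : 0 < enorm p by rewrite lt_neqAle eq_sym p0 enorm_ge0.
have vp : 0 < enorm v by rewrite lt_neqAle eq_sym v0 enorm_ge0.
have := enorm2_ge0 (enorm v *: p + (- enorm p) *: v).
rewrite enorm2D !enorm2Z dotpZl dotpZr -!sqr_enorm => H.
rewrite -(ler_pM2l (mulr_gt0 pp vp)); nra.
Qed.

Lemma normr_dotp_le p v : `|dotp p v| <= enorm p * enorm v.
Proof. by rewrite ler_norml dotp_le andbT lerNl -dotpNr -[enorm v]enormN dotp_le. Qed.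

Lemma enormD_le v w : enorm (v + w) <= enorm v + enorm w.
Proof.
rewrite -(ler_pXn2r (n := 2))// ?nnegrE ?addr_ge0 ?enorm_ge0//.
rewrite sqrrD !sqr_enorm enorm2D; have := dotp_le v w; lra.
Qed.

Lemma le_coord_enorm v i : `|v ord0 i| <= enorm v.
Proof.
rewrite -sqrtr_sqr ler_wsqrtr// /enorm2 (bigD1 i)//= lerDl.
by apply: sumr_ge0 => j _; exact: sqr_ge0.
Qed.

Lemma le_coord_norm v i : `|v ord0 i| <= `|v|.
Proof.
rewrite [leRHS]/Num.norm/= mx_normrE.
exact: (le_bigmax_cond 0 (fun i : 'I_1 * 'I_d => `|v i.1 i.2|)
  (isT : predT (ord0, i))).
Qed.

Lemma norm_le_bound v (M : R) :
  0 <= M -> (forall i, `|v ord0 i| <= M) -> `|v| <= M.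
Proof.
move=> M0 vM; rewrite [leLHS]/Num.norm/= mx_normrE.
by apply/bigmax_leP; split => // -[i j] _; rewrite ord1.
Qed.

Lemma norm_le_enorm v : `|v| <= enorm v.
Proof. by apply: norm_le_bound => [|i]; [exact: enorm_ge0|exact: le_coord_enorm]. Qed.

Lemma continuous_enorm2 : continuous (@enorm2 R d).
Proof.
apply: continuous_big => [|i _ v]; first exact: add_continuous.
have vi := @coord_continuous R 1 d ord0 i v.
exact: (@cvgM _ _ (nbhs v) _ _ _ _ _ vi vi).
Qed.

Lemma continuous_dotp p : continuous (dotp p).
Proof.
apply: continuous_big => [|i _ v]; first exact: add_continuous.
have vi := @coord_continuous R 1 d ord0 i v.
exact: (@cvgMr _ _ (nbhs v) _ _ _ _ vi).
Qed.

End Euclid.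

(** * Compactness of the torus through the unit cube, and coercive minimization *)

Section Compactness.
Variables (R : realType) (d : nat).
Local Notation V := 'rV[R]_d.

Lemma exists_shift_unit_cube (x : V) :
  exists k : 'rV[int]_d, forall i, `[0, 1]%classic ((x + intvec R k) ord0 i).
Proof.
exists (\row_i (- Num.floor (x ord0 i))) => i; rewrite /= in_itv/= !mxE.
have := Num.Theory.floor_itv (x ord0 i).
by rewrite rmorphN/= subr_ge0 => /andP[-> /ltW]; rewrite rmorphD/= lerBlDl.
Qed.

Lemma compact_cubeX (rho : R) :
  compact ([set x : V | forall i, `[0, 1]%classic (x ord0 i)] `*`
           [set v : V | forall i, `[- rho, rho]%classic (v ord0 i)]).
Proof.
apply: compact_setX.
  by apply: (@rV_compact R d (fun=> `[0, 1]%classic)) => _; exact: segment_compact.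
apply: (@rV_compact R d (fun=> `[- rho, rho]%classic)) => _.
exact: segment_compact.
Qed.

Variable L : V -> V -> R.
Hypothesis Lcont : continuous (fun z : V * V => L z.1 z.2).
Hypothesis Lper : forall v : V, Zperiodic (fun x => L x v).

(** Compactness is applied to the base point and the velocity only. One integer translation moves
    [x] into the cube and is applied to [x'] as well, which may then lie outside it. *)
Lemma periodic_unif_continuous (rho e : R) : 0 < e ->
  exists2 del : R, 0 < del & forall x x' v : V, `|v| <= rho ->
    `|x' - x| < del -> `|L x' v - L x v| <= e.
Proof.
move=> e0.
have /compact_near_coveringP K := @compact_cubeX rho.
have := K _ (0^'+) (fun (dl : R) (z : V * V) => forall x' : V,
  `|x' - z.1| < dl -> `|L x' z.2 - L z.1 z.2| <= e) _.
case=> [z _|dl /= dl0 Hdl].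
  have e20 : 0 < e / 2 by rewrite divr_gt0.
  have /cvgrPdist_lt /(_ _ e20) /nbhs_ballP[r /= r0 Hr] := @Lcont z.
  (* Half the radius for the base point and half for the increment keep [x'] in the ball of radius
     [r] around [z.1]. *)
  exists (ball z (r / 2), [set dl : R | 0 < dl < r / 2]).
    split; first by apply: nbhsx_ballx; rewrite divr_gt0.
    near=> dl; rewrite /=; apply/andP; split; first by near: dl; exact: nbhs_right_gt.
    by near: dl; apply: nbhs_right_lt; rewrite divr_gt0.
  move=> [z' dl] /= [[z1 z2] /andP[dl0 dlr]] x' x'z.
  move: z1 z2; rewrite -ball_normE /ball_/= => z1 z2.
  have h1 : `|L z.1 z.2 - L z'.1 z'.2| < e / 2.
    by apply: Hr; split; rewrite -ball_normE /ball_/=;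
      [apply: lt_le_trans z1 _|apply: lt_le_trans z2 _];
      rewrite ler_pdivrMr// ler_peMr ?ltW// ltr1n.
  have h2 : `|L z.1 z.2 - L x' z'.2| < e / 2.
    apply: (Hr (x', z'.2)); split; rewrite -ball_normE /ball_/=; last first.
      by apply: lt_le_trans z2 _; rewrite ler_pdivrMr// ler_peMr ?ltW// ltr1n.
    rewrite (_ : z.1 - x' = (z.1 - z'.1) - (x' - z'.1)); last by rewrite opprB addrA subrK.
    apply: le_lt_trans (ler_normB _ _) _.
    by rewrite [r]splitr ltrD// (lt_trans x'z).
  move: h1 h2; rewrite !ltr_norml => /andP[? ?] /andP[? ?].
  by rewrite ler_norml; apply/andP; split; lra.
exists (dl / 2) => [|x x' v vr xx']; first by rewrite divr_gt0.
have [k Hk] := exists_shift_unit_cube x.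
rewrite -(Lper v x k) -(Lper v x' k).
apply: (Hdl (dl / 2) _ _ (x + intvec R k, v)) => //=.
- by rewrite sub0r normrN gtr0_norm ?divr_gt0// ltr_pdivrMr// ltr_pMr// ltr1n.
- by rewrite divr_gt0.
- split => //= i; rewrite in_itv/= -ler_norml.
  exact: le_trans (le_coord_norm _ _) vr.
- by rewrite opprD addrACA subrr addr0.
Unshelve. all: by end_near. Qed.

Lemma periodic_bounded (rho : R) :
  exists C : R, forall x v : V, `|v| <= rho -> `|L x v| <= C.
Proof.
have /compact_bounded[C [_ HC]] := continuous_compact
  (continuous_subspaceT Lcont) (@compact_cubeX rho).
exists (C + 1) => x v vr.
have [k Hk] := exists_shift_unit_cube x; rewrite -(Lper v x k).
apply: HC; first by rewrite ltrDl.
exists (x + intvec R k, v) => //; split => //= i; rewrite in_itv/= -ler_norml.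
exact: le_trans (le_coord_norm _ _) vr.
Qed.

End Compactness.

(** Where [f] is at least [f 0] nothing is lost, and the rest lies in a compact cube. The maximum
    with 0 guarantees that this cube contains the origin. *)
Lemma exists_minimizer_coercive (R : realType) (d : nat) (f : 'rV[R]_d -> R) :
  continuous f -> (forall C, exists rho, forall v, rho <= enorm v -> C <= f v) ->
  exists v, forall w, f v <= f w.
Proof.
move=> fc coer; have [rho Hrho] := coer (f 0).
have rho0 : 0 <= Num.max rho 0 by rewrite le_max lexx orbT.
have [|||v _ Hv] := @EVT_min_rV R d f [set v | forall i,
    `[- Num.max rho 0, Num.max rho 0]%classic (v ord0 i)].
- by exists 0 => i /=; rewrite mxE in_itv/= oppr_le0 rho0.
- apply: (@rV_compact R d (fun=> `[- Num.max rho 0, Num.max rho 0]%classic)) => _.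
  exact: segment_compact.
- exact: continuous_subspaceT.
exists v => w; have [wr|wr] := leP (enorm w) (Num.max rho 0).
  apply: Hv; rewrite inE/= => i; rewrite in_itv/= -ler_norml.
  exact: le_trans (le_coord_enorm _ _) wr.
apply: (@le_trans _ _ (f 0)).
  by apply: Hv; rewrite inE/= => i; rewrite mxE in_itv/= oppr_le0 rho0.
by apply: Hrho; apply: le_trans (ltW wr); rewrite le_max lexx.
Qed.

(** * Hadamard subgradients from quadratic minorants *)

Section Differentials.
Variables (R : realType) (d : nat).
Local Notation V := 'rV[R]_d.

Lemma hsubdiff_quadratic (psi : V -> R) (z p : V) (c : R) : 0 <= c ->
  (forall w, psi z + dotp p w - c * enorm2 w <= psi (z + w)) ->
  hsubdiff psi z p.
Proof.
(* The errors are [enorm p * enorm (w' - w)] and [h * (c * enorm2 w')], where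
   [enorm w' <= enorm w + 1]. [A] adds up their coefficients, so [h] and [enorm (w' - w)] below
   [e / A] suffice. *)
move=> c0 H w e e0; pose A := enorm p + c * (enorm w + 1) ^+ 2 + 1.
have w0 := enorm_ge0 w; have p0 := enorm_ge0 p.
have q0 : 0 <= c * (enorm w + 1) ^+ 2 by rewrite mulr_ge0 ?sqr_ge0.
have A0 : 0 < A by rewrite /A; lra.
exists (Num.min 1 (e / A)) => [|h w' h0].
  by rewrite lt_min ltr01 divr_gt0.
rewrite !lt_min => /andP[h1 hA] /andP[w1 wA].
rewrite ler_pdivlMr//; have := H (h *: w'); rewrite dotpZr enorm2Z => Hh.
have w'E : w' = w + (w' - w) by rewrite addrC subrK.
have dp : - (enorm p * enorm (w' - w)) <= dotp p (w' - w).
  by have := normr_dotp_le p (w' - w); rewrite ler_norml => /andP[].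
have nw' : enorm2 w' <= (enorm w + 1) ^+ 2.
  rewrite -sqr_enorm lerXn2r ?nnegrE ?enorm_ge0 ?addr_ge0//.
  by rewrite w'E (le_trans (enormD_le _ _))// lerD2l ltW.
have pw : enorm p * enorm (w' - w) <= enorm p * (e / A).
  by rewrite ler_wpM2l// ltW.
have hw : h * (c * enorm2 w') <= e / A * (c * (enorm w + 1) ^+ 2).
  apply: ler_pM; [exact: ltW|by rewrite mulr_ge0 ?enorm2_ge0|exact: ltW|].
  exact: ler_wpM2l.
have eA : e / A * A = e by rewrite divfK// gt_eqF.
have eA0 : 0 <= e / A by rewrite divr_ge0// ltW.
have dw' : dotp p w' = dotp p w + dotp p (w' - w) by rewrite {1}w'E dotpDr.
have key : dotp p w - e <= dotp p w' - h * (c * enorm2 w').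
  by rewrite dw'; rewrite /A in eA hw pw eA0 *; nra.
have := ler_wpM2r (ltW h0) key; nra.
Qed.

Lemma hsubdiffN (phi : V -> R) (z p : V) :
  hsubdiff (fun x => - phi x) z p -> hsuperdiff phi z (- p).
Proof.
move=> H w e e0; have [del del0 Hdel] := H w e e0.
exists del => // h w' h0 hd wd; have := Hdel h w' h0 hd wd.
by rewrite dotpNl -opprD mulNr; lra.
Qed.

End Differentials.

(** * Inf-convolution (Moreau envelope) and its minimizers *)

Section Moreau.
Variables (R : realType) (d : nat).
Local Notation V := 'rV[R]_d.
Implicit Types (psi m : V -> R) (x w : V).

Lemma exists_moreau_argmin psi (c : R) : continuous psi ->
  (exists B, forall x, `|psi x| <= B) -> 0 < c ->
  exists b : V -> V, forall x v,
    psi (x + b x) + c * enorm2 (b x) <= psi (x + v) + c * enorm2 v.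
Proof.
move=> psic [B HB] c0.
suff /choice[b Hb] : forall x, exists bx, forall v,
  psi (x + bx) + c * enorm2 bx <= psi (x + v) + c * enorm2 v by exists b.
move=> x.
apply: (@exists_minimizer_coercive _ _ (fun v => psi (x + v) + c * enorm2 v)).
- move=> v.
  have h1 : (fun v => psi (x + v)) @ v --> psi (x + v).
    apply: (@continuous_comp _ _ _ (fun v => x + v)); last exact: psic.
    by apply: (@cvgD _ _ _ (nbhs v)); [exact: cvg_cst|exact: cvg_id].
  have h2 : (fun v => c * enorm2 v) @ v --> c * enorm2 v.
    by apply: (@cvgMr _ _ (nbhs v)); exact: continuous_enorm2.
  exact: (@cvgD _ R^o _ (nbhs v) _ _ _ _ _ h1 h2).
(* With [t] the quotient, [n >= t + 1] gives [n ^+ 2 >= t], so the quadratic term is at least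
   [C + B] and makes up for [psi >= - B]. *)
- move=> C; exists (`|C + B| / c + 1) => v Hv.
  have := HB (x + v); rewrite ler_norml => /andP[? _].
  have t0 : 0 <= `|C + B| / c by rewrite divr_ge0// ltW.
  have tc : `|C + B| / c * c = `|C + B| by rewrite divfK// gt_eqF.
  have := ler_norm (C + B); rewrite -sqr_enorm.
  set t := _ / c in Hv t0 tc *; set n := enorm v in Hv * => hC.
  have tn : t <= n ^+ 2 by nra.
  have := ler_wpM2l (ltW c0) tn; lra.
Qed.

Definition moreau_env psi (b : V -> V) (c : R) x : R :=
  psi (x + b x) + c * enorm2 (b x).

(** The first-order condition at the minimizer. For [c = 1 / (2 kappa^2)] this is the feedback
    momentum [pfeed]. *)
Definition moreau_grad (b : V -> V) (c : R) x : V := (- (2 * c)) *: b x.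

Variables (psi : V -> R) (b : V -> V) (c : R).
Hypothesis c_gt0 : 0 < c.
Hypothesis bmin : forall x v,
  psi (x + b x) + c * enorm2 (b x) <= psi (x + v) + c * enorm2 v.
Local Notation m := (moreau_env psi b c).
Local Notation g := (moreau_grad b c).

(** Minimality of [b x] against [b x + w] is a quadratic minorant of [psi] at [x + b x]. *)
Lemma hsubdiff_moreau x : hsubdiff psi (x + b x) (g x).
Proof.
apply: (hsubdiff_quadratic (ltW c_gt0)) => w.
have := bmin x (b x + w); rewrite addrA enorm2D dotpZl; nra.
Qed.

(** From [x + w], the competitor [b x - w] reaches the same point [x + b x]. *)
Lemma moreau_env_step x w : m (x + w) <= m x + dotp (g x) w + c * enorm2 w.
Proof.
have := bmin (x + w) (b x - w).
rewrite (_ : x + w + (b x - w) = x + b x); last first.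
  by rewrite addrACA subrr addr0.
rewrite enorm2D dotpNr enorm2N dotpZl /moreau_env; nra.
Qed.

Lemma moreau_env_le x : m x <= psi x.
Proof. by have := bmin x 0; rewrite addr0 enorm20 mulr0 addr0. Qed.

Lemma enorm_moreau_grad x : enorm (g x) = 2 * c * enorm (b x).
Proof. by rewrite enormZ normrN gtr0_norm// mulr_gt0. Qed.

(** Comparison with [v = 0] gives [c |b x|^2 <= psi x - psi (x + b x) <= K |b x|]. So displacements
    are of order [1 / c] and gradients are at most [2 K]. *)
Lemma moreau_displacement_le (K : R) x :
  (forall x w, psi (x + w) <= psi x + K * enorm w) -> 0 <= K ->
  c * enorm (b x) <= K.
Proof.
move=> lip K0; have := bmin x 0; rewrite addr0 enorm20 mulr0 addr0.
have := lip (x + b x) (- b x); rewrite addrK enormN -sqr_enorm => h1 h2.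
have [b0|b0] := leP (enorm (b x)) 0.
  by have := enorm_ge0 (b x); have := c_gt0; nra.
by rewrite -(ler_pM2r b0); nra.
Qed.

Lemma moreau_env_ge (K : R) x :
  (forall x w, psi (x + w) <= psi x + K * enorm w) -> 0 <= K ->
  psi x - K ^+ 2 / c <= m x.
Proof.
move=> lip K0; have bK := moreau_displacement_le x lip K0.
have := lip (x + b x) (- b x); rewrite addrK enormN /moreau_env => h1.
have : K * enorm (b x) <= K ^+ 2 / c by rewrite ler_pdivlMr//; nra.
have := mulr_ge0 (ltW c_gt0) (enorm2_ge0 (b x)); lra.
Qed.

End Moreau.

(** * Lipschitz bounds from bounded subgradients *)

Section Lipschitz.
Variables (R : realType) (d : nat).
Local Notation V := 'rV[R]_d.
Implicit Types (psi m : V -> R) (x w : V).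

(** Going from [x] to [x + w] in [n] equal steps leaves the linear term unchanged and divides the
    quadratic one by [n]. *)
Lemma lipschitz_of_quadratic_steps m (K c : R) :
  (forall x w, m (x + w) <= m x + K * enorm w + c * enorm2 w) ->
  forall x w, m (x + w) <= m x + K * enorm w.
Proof.
move=> H x w.
have step n u : m (x + n%:R *: u) <= m x + n%:R * (K * enorm u + c * enorm2 u).
  elim: n => [|n IH]; first by rewrite scale0r addr0 mul0r addr0.
  rewrite -natr1 scalerDl scale1r addrA; have := H (x + n%:R *: u) u.
  by rewrite mulrDl mul1r; lra.
apply/ler_addgt0Pl => e e0.
pose n := (Num.truncn (`|c| * enorm2 w / e)).+1.
have n0 : (0 : R) < n%:R by rewrite ltr0n.
have nE : `|c| * enorm2 w / e < n%:R.
  by apply: truncnS_gt.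
have := step n (n%:R^-1 *: w); rewrite scalerA divff ?gt_eqF// scale1r => h.
apply: (le_trans h); rewrite enormZ enorm2Z gtr0_norm ?invr_gt0//.
have -> : n%:R * (K * (n%:R^-1 * enorm w) + c * (n%:R^-1 ^+ 2 * enorm2 w)) =
   K * enorm w + c * enorm2 w / n%:R by field; rewrite pnatr_eq0.
rewrite addrA addrC lerD2r ler_pdivrMr//.
move: nE; rewrite ltr_pdivrMr// => nE.
have := ler_wpM2r (enorm2_ge0 w) (ler_norm c); lra.
Qed.

(** Gradients of the envelope are subgradients of [psi], so the envelope is [K]-Lipschitz for every
    [c]. For large [c] it is close enough to [psi] at [x + w], by continuity there. *)
Lemma lipschitz_of_bounded_subdiff psi (K : R) : continuous psi ->
  (exists B, forall x, `|psi x| <= B) ->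
  (forall x p, hsubdiff psi x p -> enorm p <= K) ->
  forall x w, psi (x + w) <= psi x + K * enorm w.
Proof.
move=> psic bd HK x w; apply/ler_addgt0Pl => e e0.
have /cvgrPdist_lt /(_ _ e0) /nbhs_ballP[dl /= dl0 Hdl] := psic (x + w).
(* Since [2 * c * enorm (b (x + w)) <= K], this [c] forces the displacement below [dl]. *)
pose c := `|K| / dl + 1.
have c0 : 0 < c by rewrite /c ltr_pwDr// divr_ge0// ltW.
have [b bmin] := exists_moreau_argmin psic bd c0.
have gK z : enorm (moreau_grad b c z) <= K by apply: HK; exact: hsubdiff_moreau bmin z.
have mlip : moreau_env psi b c (x + w) <= moreau_env psi b c x + K * enorm w.
  apply: (lipschitz_of_quadratic_steps (c := c)) => y v.
  apply: (le_trans (moreau_env_step bmin y v)); rewrite lerD2r lerD2l.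
  by rewrite (le_trans (dotp_le _ _))// ler_wpM2r// enorm_ge0.
have mx := moreau_env_le bmin x.
have bd' : enorm (b (x + w)) < dl.
  have := gK (x + w); rewrite enorm_moreau_grad// => h.
  have cd : c * dl = `|K| + dl by rewrite /c mulrDl mul1r divfK// gt_eqF.
  have := ler_norm K; have := enorm_ge0 (b (x + w)).
  rewrite -(ltr_pM2l c0) cd => h1 h2; nra.
have : `|psi (x + w) - psi (x + w + b (x + w))| < e.
  apply: Hdl; rewrite -ball_normE /ball_/= opprD addrA subrr sub0r normrN.
  exact: le_lt_trans (norm_le_enorm _) bd'.
rewrite ltr_norml => /andP[_ h3].
have := mulr_ge0 (ltW c0) (enorm2_ge0 (b (x + w))).
move: mlip; rewrite {1}/moreau_env; lra.
Qed.

End Lipschitz.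

(** * Integrals over adjacent and over short intervals *)

Section Integration.

(* Unlike [ge0_le_integral] and [le_integral], no measurability is assumed. *)
Lemma le_integral_pointwise (di : measure_display) (T : measurableType di)
    (R : realType) (mu : {measure set T -> \bar R}) (D : set T)
    (f g : T -> \bar R) : (forall x, D x -> f x <= g x)%E ->
  (\int[mu]_(x in D) f x <= \int[mu]_(x in D) g x)%E.
Proof.
(* For nonnegative functions the integral is a supremum over simple functions below, which is
   monotone. The general case compares positive and negative parts. *)
have ge0 (h k : T -> \bar R) : (forall x, 0 <= h x)%E ->
    (forall x, h x <= k x)%E -> (\int[mu]_x h x <= \int[mu]_x k x)%E.
  move=> h0 hk; rewrite !ge0_integralTE//; last first.
    by move=> x; exact: le_trans (h0 x) (hk x).
  apply: ereal_sup_le => _ [s sh <-]; exists s => // x.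
  exact: le_trans (sh x) (hk x).
move=> fg; rewrite (integral_mkcond D f) (integral_mkcond D g).
have fgD x : (f \_ D x <= g \_ D x)%E.
  by rewrite !patchE; case: ifPn => // /set_mem; exact: fg.
rewrite integralE [leRHS]integralE; apply: leeB; apply: ge0 => x //.
- by rewrite !funeposE ge_max !le_max lexx fgD orbT.
- by rewrite !funenegE ge_max !le_max lexx leeN2 fgD orbT.
Qed.

Lemma integrable_setU (di : measure_display) (T : measurableType di)
    (R : realType) (mu : {measure set T -> \bar R}) (A B : set T)
    (f : T -> \bar R) : measurable A -> measurable B -> [disjoint A & B] ->
  mu.-integrable A f -> mu.-integrable B f -> mu.-integrable (A `|` B) f.
Proof.
move=> mA mB AB /integrableP[mfA fA] /integrableP[mfB fB].
have mf : measurable_fun (A `|` B) f by apply/measurable_funU.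
apply/integrableP; split => //.
rewrite ge0_integral_setU//; first exact: lte_add_pinfty.
exact: measurableT_comp.
Qed.

Variable R : realType.
Local Notation mu := (@lebesgue_measure R).
Implicit Types (f g : R -> R) (a b c k : R).

Lemma integrable_cst_itv a b k : mu.-integrable `[a, b] (EFin \o cst k).
Proof.
apply: measurable_bounded_integrable => //.
- by rewrite /= lebesgue_measure_itv/=; case: ifP; rewrite ?ltry.
- by exists `|k|; split => // M kM x _ /=; exact: ltW.
Qed.

Lemma Rintegral_cst_itv a b k : a <= b -> \int[mu]_(_ in `[a, b]) k = k * (b - a).
Proof.
rewrite le_eqVlt => /predU1P[->|ab].
  by rewrite set_itv1 Rintegral_set1 subrr mulr0.
by rewrite Rintegral_cst ?measurable_itv//= lebesgue_measure_itv/= lte_fin ab.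
Qed.

Lemma EFin_Rintegral f a b : mu.-integrable `[a, b] (EFin \o f) ->
  (\int[mu]_(t in `[a, b]) f t)%:E = (\int[mu]_(t in `[a, b]) (f t)%:E)%E.
Proof. by move=> intf; rewrite /Rintegral fineK//; exact: integrable_fin_num. Qed.

(** The breakpoint [b] belongs to the right piece, as in [pw_traj] and [pw_ctrl]. *)
Lemma integrable_glue f g a b c : a <= b -> b <= c ->
  mu.-integrable `[a, b] (EFin \o f) -> mu.-integrable `[b, c] (EFin \o g) ->
  mu.-integrable `[a, c] (EFin \o (fun t => if t < b then f t else g t)).
Proof.
move=> ab bc intf intg; set h := fun t => if _ then _ else _.
have E : `[a, c]%classic = `[a, b[%classic `|` `[b, c]%classic.
  by rewrite -itv_bndbnd_setU// bnd_simp.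
have intf' : mu.-integrable `[a, b[ (EFin \o f).
  by apply: integrableS intf => //; apply: subset_itvl; rewrite bnd_simp.
have inth1 : mu.-integrable `[a, b[ (EFin \o h).
  apply: eq_integrable intf' => // x; rewrite inE/= in_itv/= => /andP[_ xb].
  by rewrite /h xb.
have inth2 : mu.-integrable `[b, c] (EFin \o h).
  apply: eq_integrable intg => // x; rewrite inE/= in_itv/= => /andP[bx _].
  by rewrite /h ltNge bx.
rewrite E; apply: integrable_setU => //.
apply/disj_setPS => y [/=]; rewrite 2!in_itv/= => /andP[_ yx] /andP[].
by rewrite leNgt yx.
Qed.

Lemma Rintegral_glue f g a b c : a <= b -> b <= c ->
  mu.-integrable `[a, b] (EFin \o f) -> mu.-integrable `[b, c] (EFin \o g) ->
  \int[mu]_(t in `[a, c]) (if t < b then f t else g t) =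
  \int[mu]_(t in `[a, b]) f t + \int[mu]_(t in `[b, c]) g t.
Proof.
move=> ab bc intf intg; have := integrable_glue ab bc intf intg.
have E : `[a, c]%classic = `[a, b[%classic `|` `[b, c]%classic.
  by rewrite -itv_bndbnd_setU// bnd_simp.
rewrite E => inth; rewrite Rintegral_setU//; last first.
  apply/disj_setPS => y [/=]; rewrite 2!in_itv/= => /andP[_ yx] /andP[].
  by rewrite leNgt yx.
congr (_ + _); last first.
  apply: eq_Rintegral => x; rewrite inE/= in_itv/= => /andP[bx _].
  by rewrite ltNge bx.
rewrite -[RHS]Rintegral_itv_bndo_bndc; last first.
  by apply: integrableS intf => //; apply: subset_itvl; rewrite bnd_simp.
by apply: eq_Rintegral => x; rewrite inE/= in_itv/= => /andP[_ ->].
Qed.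

Lemma integrable_sub_itv f a b a' b' : a' <= a -> b <= b' ->
  mu.-integrable `[a', b'] (EFin \o f) -> mu.-integrable `[a, b] (EFin \o f).
Proof.
move=> aa bb; apply: integrableS => //.
by apply: subset_itv; rewrite bnd_simp.
Qed.

Lemma Rintegral_chasles f a b c : a <= b -> b <= c ->
  mu.-integrable `[a, c] (EFin \o f) ->
  \int[mu]_(t in `[a, c]) f t =
  \int[mu]_(t in `[a, b]) f t + \int[mu]_(t in `[b, c]) f t.
Proof.
move=> ab bc intf; rewrite -(Rintegral_glue ab bc).
- by apply: eq_Rintegral => x _; rewrite if_same.
- exact: integrable_sub_itv intf.
- exact: integrable_sub_itv intf.
Qed.

(** Absolute continuity of the integral, applied to [f] extended by 0 to the whole line. *)
Lemma Rintegral_small_itv f (r e : R) :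
  mu.-integrable `[0, r] (EFin \o f) -> 0 < e ->
  exists2 del, 0 < del & forall s t, 0 <= s -> s <= t -> t <= r ->
    t - s < del -> `|\int[mu]_(u in `[s, t]) f u| <= e.
Proof.
move=> intf e0.
have : mu.-integrable setT (EFin \o f \_ `[0, r]).
  by rewrite -restrict_EFin; apply/integrable_restrict => //=; rewrite setTI.
move=> /integral_normr_continuous /(_ _ e0)[dl [dl0 /= H]].
exists dl => // s t s0 st tr std.
have sub : `[s, t]%classic `<=` `[0, r]%classic.
  by apply: subset_itv; rewrite bnd_simp.
have -> : \int[mu]_(u in `[s, t]) f u = \int[mu]_(u in `[s, t]) (f \_ `[0, r]) u.
  by apply: eq_Rintegral => x /set_mem /sub /mem_set xr; rewrite patchE xr.
apply: le_trans (le_normr_Rintegral _ _) _ => //.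
  have intst : mu.-integrable `[s, t] (EFin \o f) by exact: integrableS intf.
  apply: eq_integrable intst => // x /set_mem /sub /mem_set xr.
  by rewrite /= patchE xr.
apply/ltW/H => //; rewrite lebesgue_measure_itv/= lte_fin.
by case: ifP => _; rewrite lte_fin.
Qed.

Lemma Rintegral_sum (n : nat) (D : set R) (F : 'I_n -> R -> R) : measurable D ->
  (forall i, mu.-integrable D (EFin \o F i)) ->
  \int[mu]_(t in D) (\sum_(i < n) F i t) = \sum_(i < n) \int[mu]_(t in D) F i t.
Proof.
move=> mD intF; rewrite /Rintegral.
under eq_integral do rewrite -sumEFin.
rewrite integral_sum//; apply/EFin_inj; rewrite fineK; last first.
  by apply/sum_fin_numP => i _ _; apply: integrable_fin_num => //; exact: intF.
rewrite -sumEFin; apply: eq_bigr => i _; rewrite fineK//.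
by apply: integrable_fin_num => //; exact: intF.
Qed.

End Integration.

(** * Existence of fine partitions *)

Section Partitions.
Variable R : realType.
Local Notation gaps := (pairmap (fun a b : R => b - a)).

Lemma path_lt_le_last (a : R) (s : seq R) : path <%R a s -> a <= last a s.
Proof.
elim: s a => //= b s IH a /andP[ab /IH]; exact: le_trans (ltW ab).
Qed.

Lemma exists_fine_path (n : nat) (a h : R) : 0 < h ->
  exists s, [/\ size s = n.+1, path <%R a s, last a s = a + n.+1%:R * h &
    foldr Num.max 0 (gaps a s) <= h].
Proof.
move=> h0; elim: n a => [|n IH] a.
  exists [:: a + h]; split => //=; first by rewrite ltrDl h0.
  - by rewrite mul1r.
  - by rewrite addrC addKr ge_max lexx ltW.
have [s [ss ps ls gs]] := IH (a + h).
exists (a + h :: s); split => /=; first by rewrite ss.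
- by rewrite ltrDl h0.
- by rewrite ls -[n.+2%:R]natr1; ring.
- by rewrite ge_max gs andbT addrC addKr.
Qed.

Lemma exists_fine_partition (r del : R) : 0 < r -> 0 < del ->
  exists ts, is_partition r ts /\ fineness ts < del.
Proof.
move=> r0 del0; pose n := Num.truncn (r / del).
have n0 : (0 : R) < n.+1%:R by rewrite ltr0n.
have nE : r / del < n.+1%:R by exact: truncnS_gt.
have [s [ss ps ls gs]] := @exists_fine_path n 0 (r / n.+1%:R) (divr_gt0 r0 n0).
exists (0 :: s); split; last first.
  by apply: le_lt_trans gs _; rewrite ltr_pdivrMr// mulrC -ltr_pdivrMr.
by split => //=; [rewrite ss|rewrite ls add0r mulrC divfK// gt_eqF].
Qed.

End Partitions.

(** * Lower bound of the action along a controlled process *)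

Section LowerBound.
Variables (R : realType) (d : nat).
Local Notation V := 'rV[R]_d.
Local Notation mu := (@lebesgue_measure R).
Local Notation gaps := (pairmap (fun a b : R => b - a)).

Lemma integrable_dotp (D : set R) (p : V) (v : R -> V) : measurable D ->
  (forall i, mu.-integrable D (fun t => (v t ord0 i)%:E)) ->
  mu.-integrable D (fun t => (dotp p (v t))%:E).
Proof.
move=> mD iv; rewrite /dotp; under eq_fun do rewrite -sumEFin.
apply: integrable_sum => // i _; under eq_fun do rewrite EFinM.
exact: integrableZl.
Qed.

Lemma Rintegral_dotp (D : set R) (p : V) (v : R -> V) : measurable D ->
  (forall i, mu.-integrable D (fun t => (v t ord0 i)%:E)) ->
  \int[mu]_(t in D) dotp p (v t) = dotp p (vintegral D v).
Proof.
move=> mD iv; rewrite Rintegral_sum// => [|i].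
  by apply: eq_bigr => i _; rewrite RintegralZl ?/vintegral ?mxE//; exact: iv.
rewrite /comp; under eq_fun do rewrite EFinM.
exact: integrableZl.
Qed.

Variables (r : R) (x v : R -> V).
Hypothesis xv : controlled_process r x v.

Lemma process_integrable s t i : 0 <= s -> t <= r ->
  mu.-integrable `[s, t] (fun u => (v u ord0 i)%:E).
Proof. by move=> s0 tr; apply: integrable_sub_itv (xv.1 i). Qed.

Lemma process_increment s t : 0 <= s -> s <= t -> t <= r ->
  x t - x s = vintegral `[s, t] v.
Proof.
move=> s0 st tr; rewrite (xv.2 t) ?(le_trans s0 st)//.
rewrite (xv.2 s) ?s0 ?(le_trans st tr)// opprD addrACA subrr add0r.
apply/rowP => i; rewrite /vintegral !mxE (Rintegral_chasles s0 st).
  by rewrite addrC addKr.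
exact: process_integrable.
Qed.

Lemma process_unif_continuous (eta : R) : 0 < eta ->
  exists2 del, 0 < del & forall s t i, 0 <= s -> s <= t -> t <= r ->
    t - s < del -> `|(x t - x s) ord0 i| <= eta.
Proof.
move=> eta0.
have /choice[dl Hdl] : forall i : 'I_d, exists del : R, 0 < del /\
    forall s t, 0 <= s -> s <= t -> t <= r -> t - s < del ->
      `|\int[mu]_(u in `[s, t]) v u ord0 i| <= eta.
  move=> i; have [del del0 H] := Rintegral_small_itv (xv.1 i) eta0.
  by exists del.
(* The starting value 1 keeps the radius positive when [d = 0]. *)
exists (\big[Num.min/1]_(i < d) dl i).
  elim/big_ind: _ => [|a b a0 b0|i _]; last exact: (Hdl i).1.
    exact: ltr01.
  by rewrite lt_min a0.
move=> s t i s0 st tr std; rewrite process_increment// /vintegral mxE.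
by apply: (Hdl i).2 => //; apply: (lt_le_trans std); exact: bigmin_le_cond.
Qed.

Variables (m : V -> R) (p : V -> V) (c C : R) (f : R -> R).
Hypothesis c_ge0 : 0 <= c.
Hypothesis mstep : forall y w, m (y + w) <= m y + dotp (p y) w + c * enorm2 w.

(** As [f] is not assumed integrable, the sum is carried by an integrable [g]: on each cell, the
    bound with the gradient frozen at the left endpoint. Its integral is the linear term of [mstep]
    minus [C] times the length. *)
Lemma integrable_minorant (del eta : R) (s : seq R) (t0 : R) :
  (forall s t, 0 <= s -> s <= t -> t <= r -> t - s < del ->
    dotp (p (x s)) (v t) - C <= f t) ->
  (forall s t i, 0 <= s -> s <= t -> t <= r -> t - s < del ->
    `|(x t - x s) ord0 i| <= eta) ->
  0 < del -> 0 <= eta ->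
  0 <= t0 -> path <%R t0 s -> last t0 s = r ->
  foldr Num.max 0 (gaps t0 s) < del ->
  exists g, [/\ mu.-integrable `[t0, r] (EFin \o g),
    forall t, t0 <= t <= r -> g t <= f t &
    m (x r) - m (x t0) <= \int[mu]_(t in `[t0, r]) g t + C * (r - t0) +
      c * eta * \sum_(i < d) \int[mu]_(t in `[t0, r]) `|v t ord0 i| ].
Proof.
move=> Hf Heta del0 eta0; elim: s t0 => [|t1 s IH] t0 t00 /=.
  move=> _ t0r _; rewrite t0r.
  (* The interval is the single time [r]: its integral vanishes and only the bound at [s = t = r] is
     required. *)
  exists (cst (dotp (p (x r)) (v r) - C)); split.
  - exact: integrable_cst_itv.
  - move=> t /le_anti <-; apply: Hf => //; rewrite -?t0r//.
    by rewrite subrr.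
  - rewrite !subrr mulr0 addr0 set_itv1 Rintegral_set1 add0r.
    by rewrite big1 ?mulr0// => i _; rewrite Rintegral_set1.
move=> /andP[t01 ps] ls; rewrite gt_max => /andP[gap gs].
have t10 : 0 <= t1 by rewrite (le_trans t00)// ltW.
have t1r : t1 <= r by rewrite -ls; exact: path_lt_le_last.
have t0r : t0 <= r by exact: le_trans (ltW t01) t1r.
have [g [ig gf Hg]] := IH t1 t10 ps ls gs.
pose g1 t := dotp (p (x t0)) (v t) - C.
have iv i : mu.-integrable `[t0, t1] (fun u => (v u ord0 i)%:E).
  exact: process_integrable.
have idot := @integrable_dotp _ (p (x t0)) v (measurable_itv _) iv.
have ig1 : mu.-integrable `[t0, t1] (EFin \o g1).
  by apply: eq_integrable (integrableB _ idot (integrable_cst_itv t0 t1 C)).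
have Ig1 : \int[mu]_(t in `[t0, t1]) g1 t =
    dotp (p (x t0)) (x t1 - x t0) - C * (t1 - t0).
  rewrite RintegralB//; last exact: integrable_cst_itv.
  rewrite Rintegral_dotp// Rintegral_cst_itv ?(ltW t01)//.
  by rewrite process_increment// ltW.
exists (fun t => if t < t1 then g1 t else g t); split.
- by apply: integrable_glue => //; exact: ltW.
- move=> t /andP[t0t tr]; case: ltP => tt1; last by apply: gf; rewrite tt1.
  by apply: Hf => //; apply: lt_trans gap; rewrite ltrD2r.
rewrite Rintegral_glue ?(ltW t01)// Ig1.
have inorm i a b : 0 <= a -> b <= r ->
    mu.-integrable `[a, b] (EFin \o (fun t => `|v t ord0 i|)).
  by move=> a0 br; apply: integrable_norm; exact: process_integrable.
have -> : \sum_(i < d) \int[mu]_(t in `[t0, r]) `|v t ord0 i| =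
    \sum_(i < d) \int[mu]_(t in `[t0, t1]) `|v t ord0 i| +
    \sum_(i < d) \int[mu]_(t in `[t1, r]) `|v t ord0 i|.
  rewrite -big_split; apply: eq_bigr => i _.
  by apply: Rintegral_chasles => //; [exact: ltW|exact: inorm].
(* In each squared coordinate increment, one factor is bounded by the oscillation [eta], the other
   by the integral of the speed. *)
have n2 : enorm2 (x t1 - x t0) <=
    eta * \sum_(i < d) \int[mu]_(t in `[t0, t1]) `|v t ord0 i|.
  rewrite mulr_sumr; apply: ler_sum => i _.
  rewrite -real_normK ?num_real// expr2; apply: ler_pM => //.
    by apply: Heta => //; exact: ltW.
  rewrite process_increment ?(ltW t01)// /vintegral mxE.
  by apply: le_normr_Rintegral => //; exact: iv.
have := mstep (x t0) (x t1 - x t0); rewrite addrC subrK => Hm.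
have := ler_wpM2l c_ge0 n2.
set S1 := \sum_(i < d) _; set S2 := \sum_(i < d) _ in Hg *.
move: Hg Hm; lra.
Qed.

(** The oscillation [eta] is chosen after the total variation [S], so that the accumulated quadratic
    error [c * eta * S] is at most [e]. *)
Lemma integral_ge_of_quadratic_steps (del e : R) : 0 < r -> 0 < del -> 0 < e ->
  (forall s t, 0 <= s -> s <= t -> t <= r -> t - s < del ->
    dotp (p (x s)) (v t) - C <= f t) ->
  ((m (x r) - m (x 0) - C * r - e)%:E <= \int[mu]_(t in `[0%R, r]) (f t)%:E)%E.
Proof.
move=> r0 del0 e0 Hf.
pose S := \sum_(i < d) \int[mu]_(t in `[0, r]) `|v t ord0 i|.
have S0 : 0 <= S by apply: sumr_ge0 => i _; apply: Rintegral_ge0.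
have cS : 0 < c * S + 1 by rewrite ltr_wpDl// mulr_ge0.
pose eta := e / (c * S + 1); have eta0 : 0 < eta by rewrite divr_gt0.
have [del' del'0 Hdel'] := process_unif_continuous eta0.
have dd0 : 0 < Num.min del del' by rewrite lt_min del0.
have [ts [[ts1 t00 ls ps] fin]] := exists_fine_partition r0 dd0.
case: ts ts1 t00 ls ps fin => [//|t0 ts] _ /= -> ls ps fin.
have [g [ig gf Hg]] : exists g, [/\ mu.-integrable `[0, r] (EFin \o g),
    forall t, 0 <= t <= r -> g t <= f t &
    m (x r) - m (x 0) <= \int[mu]_(t in `[0, r]) g t + C * (r - 0) +
      c * eta * S].
  apply: (@integrable_minorant (Num.min del del') eta ts 0) => //; last exact: ltW.
  - by move=> s t s0 st tr; rewrite lt_min => /andP[? ?]; exact: Hf.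
  - by move=> s t i s0 st tr; rewrite lt_min => /andP[? ?]; exact: Hdel'.
have etaE : eta * (c * S + 1) = e by rewrite /eta divfK// gt_eqF.
have ce : c * eta * S <= e by move: eta0; rewrite -etaE; lra.
apply: (@le_trans _ _ (\int[mu]_(t in `[0%R, r]) (g t)%:E)%E).
  by rewrite -EFin_Rintegral// lee_fin; move: Hg; rewrite subr0; lra.
apply: le_integral_pointwise => t /=; rewrite in_itv/= lee_fin.
exact: gf.
Qed.

End LowerBound.

(** * The sampled feedback scheme *)

Section Scheme.
Variables (R : realType) (d : nat).
Local Notation V := 'rV[R]_d.
Local Notation mu := (@lebesgue_measure R).
Local Notation gaps := (pairmap (fun a b : R => b - a)).
Variable F : V -> V.

Lemma pw_ctrl_integrable (s : seq R) (y : V) (t0 : R) i : path <%R t0 s ->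
  mu.-integrable `[t0, last t0 s] (fun t => (pw_ctrl F y t0 s t ord0 i)%:E).
Proof.
elim: s y t0 => [|t1 s IH] y t0 /=; first by move=> _; exact: integrable_cst_itv.
move=> /andP[t01 ps]; have t1r := path_lt_le_last ps.
have := integrable_glue (ltW t01) t1r (integrable_cst_itv t0 t1 (F y ord0 i))
  (IH (y + (t1 - t0) *: F y) t1 ps).
by apply: eq_integrable => // t _ /=; case: ifP.
Qed.

(** Beyond [t1] the integral splits there into the first straight segment and the displacement of
    the scheme restarted from its end. *)
Lemma pw_trajE (s : seq R) (y : V) (t0 t : R) : path <%R t0 s ->
  t0 <= t <= last t0 s ->
  pw_traj F y t0 s t = y + vintegral `[t0, t] (pw_ctrl F y t0 s).
Proof.
elim: s y t0 => [|t1 s IH] y t0 /=.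
  move=> _ /le_anti <-; apply/rowP => i.
  by rewrite /vintegral !mxE set_itv1 Rintegral_set1 addr0.
move=> /andP[t01 ps] /andP[t0t tr]; have t1r := path_lt_le_last ps.
have [tt1|t1t] := ltP t t1.
  apply/rowP => i; rewrite /vintegral !mxE; congr (_ + _).
  rewrite (@eq_Rintegral _ _ _ _ _ (cst (F y ord0 i))).
    by rewrite Rintegral_cst_itv// mulrC.
  move=> u; rewrite inE/= in_itv/= => /andP[_ ut].
  by rewrite (le_lt_trans ut tt1).
rewrite IH ?t1t// -addrA; congr (_ + _); apply/rowP => i.
rewrite /vintegral !mxE.
pose ci (u : R) := if u < t1 then cst (F y ord0 i) u
  else pw_ctrl F (y + (t1 - t0) *: F y) t1 s u ord0 i.
transitivity (\int[mu]_(u in `[t0, t]) ci u); last first.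
  by apply: eq_Rintegral => u _; rewrite /ci; case: ifP.
rewrite Rintegral_glue ?(ltW t01)//.
- by rewrite Rintegral_cst_itv ?(ltW t01)// mulrC.
- exact: integrable_cst_itv.
- by apply: integrable_sub_itv (pw_ctrl_integrable _ _ ps).
Qed.

Lemma scheme_controlled_process (r : R) (y : V) (ts : seq R) :
  is_partition r ts -> controlled_process r (traj F y ts) (ctrl F y ts) /\
  traj F y ts 0 = y.
Proof.
case: ts => [[]//|t0 ts] [_ /= -> lr ps]; rewrite /traj /ctrl /=.
have r0 : 0 <= r by rewrite -lr; exact: path_lt_le_last.
have y0 : pw_traj F y 0 ts 0 = y.
  rewrite pw_trajE// ?lexx ?lr//; apply/rowP => i.
  by rewrite /vintegral !mxE set_itv1 Rintegral_set1 addr0.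
split=> //; split => [i|s s0r]; first by rewrite -lr; exact: pw_ctrl_integrable.
by rewrite y0 pw_trajE// lr.
Qed.

Variables (L : V -> V -> R) (m ell : V -> R) (A del : R).
Hypothesis del_gt0 : 0 < del.
Hypothesis Lell : forall y t, 0 <= t -> t < del -> L (y + t *: F y) (F y) <= ell y.
Hypothesis mstep : forall y h, 0 <= h -> h < del ->
  m (y + h *: F y) + h * ell y <= m y + h * A.

(** [g] is the step function equal on each cell to [ell] at the sampled point. It dominates the
    running cost, and [mstep] telescopes over the cells. *)
Lemma pw_majorant (s : seq R) (y : V) (t0 : R) : path <%R t0 s ->
  foldr Num.max 0 (gaps t0 s) < del ->
  exists g, [/\ mu.-integrable `[t0, last t0 s] (EFin \o g),
    forall t, t0 <= t <= last t0 s ->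
      L (pw_traj F y t0 s t) (pw_ctrl F y t0 s t) <= g t &
    m (pw_traj F y t0 s (last t0 s)) + \int[mu]_(t in `[t0, last t0 s]) g t <=
      m y + (last t0 s - t0) * A].
Proof.
elim: s y t0 => [|t1 s IH] y t0 /=.
  move=> _ _; exists (cst (ell y)); split; first exact: integrable_cst_itv.
  - by move=> t _; have := Lell y (lexx 0) del_gt0; rewrite scale0r addr0.
  - by rewrite set_itv1 Rintegral_set1 subrr mul0r.
move=> /andP[t01 ps]; rewrite gt_max => /andP[gap gs].
have t1r := path_lt_le_last ps.
have [g [ig gL Hg]] := IH (y + (t1 - t0) *: F y) t1 ps gs.
exists (fun t => if t < t1 then cst (ell y) t else g t); split.
- apply: integrable_glue => //; [exact: ltW|exact: integrable_cst_itv].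
- move=> t /andP[t0t tr]; case: ltP => tt1; last by apply: gL; rewrite tt1.
  apply: Lell; first by rewrite subr_ge0.
  by apply: lt_trans gap; rewrite ltrD2r.
rewrite ltNge t1r/= Rintegral_glue ?(ltW t01)//; last exact: integrable_cst_itv.
rewrite Rintegral_cst_itv ?(ltW t01)//.
have := mstep y (_ : 0 <= t1 - t0) gap; rewrite subr_ge0 => /(_ (ltW t01)).
by move: Hg; lra.
Qed.

(** The gap [e] between [m] and [phi] is paid once, at the final time; at the initial time
    [m <= phi] suffices. *)
Lemma scheme_cost_le (phi : V -> R) (r e : R) (y : V) (ts : seq R) :
  (forall z, m z <= phi z <= m z + e) -> is_partition r ts -> fineness ts < del ->
  (scheme_cost L phi F r y ts <= (phi y + r * A + e)%:E)%E.
Proof.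
move=> mphi; case: ts => [[]//|t0 ts] [_ /= -> lr ps] fin.
have [g [ig gL]] := pw_majorant y ps fin; rewrite lr subr0 => Hg.
have /andP[_ h1] := mphi (pw_traj F y 0 ts r); have /andP[h2 _] := mphi y.
rewrite /scheme_cost /action /traj /ctrl /=.
apply: (@le_trans _ _ ((phi (pw_traj F y 0 ts r))%:E +
   (\int[mu]_(t in `[0, r]) g t)%:E)%E).
  apply: leeD2l; rewrite EFin_Rintegral -?lr//.
  apply: le_integral_pointwise => t /=; rewrite in_itv/= lee_fin; exact: gL.
by rewrite -EFinD lee_fin; lra.
Qed.

End Scheme.

(** * The viscosity solution: regularity, action bound, scheme and Lax-Oleinik value *)

Section Main.
Variables (R : realType) (d : nat).
Local Notation V := 'rV[R]_d.
Local Notation mu := (@lebesgue_measure R).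
Variables (L : V -> V -> R) (phi : V -> R) (Hbar : R).
Hypothesis Lcont : continuous (fun z : V * V => L z.1 z.2).
Hypothesis Lper : forall v : V, Zperiodic (fun x => L x v).
Hypothesis Lsuper : forall M : R, exists R0 : R, forall x v : V,
  R0 <= enorm v -> M * enorm v <= L x v.
Hypothesis visc : viscosity_solution L phi Hbar.

Lemma solution_bounded : exists B, forall x, `|phi x| <= B.
Proof.
case: visc => phic phiper _ _.
(* [phi] is read as a Lagrangian that does not depend on the velocity. *)
have [B HB] := @periodic_bounded R d (fun x _ => phi x)
  (fun z => @continuous_comp _ _ _ fst phi z (@cvg_fst _ _ _ _ _) (phic z.1))
  (fun _ => phiper) 0.
by exists B => x; apply: (HB x 0); rewrite normr0.
Qed.

Lemma opp_solution_continuous_bounded :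
  continuous (fun x => - phi x) /\ exists B, forall x, `|- phi x| <= B.
Proof.
have [phic _ _ _] := visc; have [B HB] := solution_bounded.
split; last by exists B => x; rewrite normrN.
by move=> x; exact: (@cvgN _ R^o _ (nbhs x) _ _ _ (phic x)).
Qed.

(** Two signs cancel: [- p] is a supergradient of [phi], and the Hamiltonian is evaluated at its
    opposite. *)
Lemma superdiff_ineq x p v :
  hsubdiff (fun x => - phi x) x p -> dotp p v - L x v <= Hbar.
Proof.
case: visc => _ _ Hsup _ /hsubdiffN /Hsup; rewrite opprK => Hle.
rewrite -lee_fin; apply: le_trans Hle.
by apply: ereal_sup_ubound; exists v.
Qed.

(** Testing the subsolution inequality with the unit vector along [p] gives [enorm p <= Hbar + C],
    where [C] bounds [L] on unit velocities. *)
Lemma solution_lipschitz : exists2 K, 0 <= K &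
  forall x w, `|phi (x + w) - phi x| <= K * enorm w.
Proof.
have [C HC] := periodic_bounded Lcont Lper 1.
pose K := Num.max 0 (Hbar + C).
have K0 : 0 <= K by rewrite le_max lexx.
have [nphic nbd] := opp_solution_continuous_bounded.
have grad x p : hsubdiff (fun x => - phi x) x p -> enorm p <= K.
  move=> Hp; have [p0|p0] := eqVneq (enorm p) 0; first by rewrite p0.
  have pp : 0 < enorm p by rewrite lt_neqAle eq_sym p0 enorm_ge0.
  have := superdiff_ineq ((enorm p)^-1 *: p) Hp.
  rewrite dotpZr -enorm2E -sqr_enorm expr2 mulKf// => Hp1.
  have : `|L x ((enorm p)^-1 *: p)| <= C.
    apply: HC; apply: (le_trans (norm_le_enorm _)).
    by rewrite enormZ gtr0_norm ?invr_gt0// mulVf.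
  move=> /(le_trans (ler_norm _)) HL; rewrite /K le_max; apply/orP; right; lra.
have lip := lipschitz_of_bounded_subdiff nphic nbd grad.
exists K => // x w; rewrite ler_norml; apply/andP; split.
  by have := lip x w; lra.
by have := lip (x + w) (- w); rewrite addrK enormN; lra.
Qed.

(* A velocity that is large for the growth of [L] is handled by the Lipschitz
   bound on the Moreau gradient alone; only the bounded ones need the uniform
   continuity of [L]. *)
Lemma action_ge (r : R) (x v : R -> V) : 0 < r -> controlled_process r x v ->
  ((phi (x 0) - r * Hbar)%:E <= (phi (x r))%:E + action L r x v)%E.
Proof.
move=> r0 xv; apply/lee_addgt0Pr => e e0.
have [K K0 lip] := solution_lipschitz.
have [nphic nbd] := opp_solution_continuous_bounded.
have nlip z w : - phi (z + w) <= - phi z + K * enorm w.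
  by have := lip z w; rewrite ler_norml => /andP[+ _]; lra.
(* Three errors of size [e / 3]: the variation of [L] over the whole interval, the gap between
   [- phi] and its envelope, and the quadratic remainder. *)
pose e1 := e / (3 * r).
have e10 : 0 < e1 by rewrite divr_gt0// mulr_gt0.
have e1r : e1 * r = e / 3 by rewrite /e1; field; rewrite gt_eqF.
(* [2 * K] beats the gradient term, and [|Hbar|] absorbs the constant once the speed is at least
   1. *)
have [R0 HR0] := Lsuper (2 * K + `|Hbar|).
pose R1 := Num.max R0 1.
have [dl dl0 Hdl] := periodic_unif_continuous Lcont Lper R1 e10.
(* The first term makes the envelope gap [K ^+ 2 / c] at most [e / 3]; the second makes
   displacements smaller than [dl / 3]. *)
pose c := 3 * K ^+ 2 / e + 3 * K / dl + 1.
have a1 : 0 <= 3 * K ^+ 2 / e by rewrite divr_ge0 ?mulr_ge0 ?sqr_ge0// ltW.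
have a2 : 0 <= 3 * K / dl by rewrite divr_ge0 ?mulr_ge0// ltW.
have c0 : 0 < c by rewrite /c; lra.
have Kc : K ^+ 2 / c <= e / 3.
  have E : e / 3 * (3 * K ^+ 2 / e) = K ^+ 2 by field; rewrite gt_eqF.
  rewrite ler_pdivrMr// -E ler_wpM2l ?divr_ge0 ?ltW// /c.
  by move: a2; lra.
have Kd : K < c * (dl / 3).
  have E : (3 * K / dl) * (dl / 3) = K by field; rewrite gt_eqF.
  rewrite -[ltLHS]E ltr_pM2r ?divr_gt0// /c.
  by move: a1; lra.
have [b bmin] := exists_moreau_argmin nphic nbd c0.
pose m := moreau_env (fun x => - phi x) b c.
have bK z : enorm (b z) < dl / 3.
  rewrite -(ltr_pM2l c0); apply: le_lt_trans Kd.
  exact: moreau_displacement_le c0 bmin _ z nlip K0.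
have gK z : enorm (moreau_grad b c z) <= 2 * K.
  rewrite enorm_moreau_grad// -mulrA ler_pM2l//.
  exact: moreau_displacement_le c0 bmin _ z nlip K0.
have dl30 : 0 < dl / 3 by rewrite divr_gt0.
have [del del0 Hdel] := process_unif_continuous xv dl30.
have e30 : 0 < e / 3 by rewrite divr_gt0.
have := @integral_ge_of_quadratic_steps R d r x v xv m (moreau_grad b c) c
  (Hbar + e1) (fun t => L (x t) (v t)) (ltW c0) (moreau_env_step bmin)
  del (e / 3) r0 del0 e30.
have Hpt s t : 0 <= s -> s <= t -> t <= r -> t - s < del ->
    dotp (moreau_grad b c (x s)) (v t) - (Hbar + e1) <= L (x t) (v t).
  move=> s0 st tr std; have [vR|vR] := leP R1 (enorm (v t)).
    move: vR; rewrite /R1 ge_max => /andP[vR0 v1].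
    have h1 := HR0 (x t) (v t) vR0.
    have h2 := dotp_le (moreau_grad b c (x s)) (v t).
    have h3 := ler_wpM2r (enorm_ge0 (v t)) (gK (x s)).
    have h4 := ler_wpM2l (normr_ge0 Hbar) v1.
    have h5 := ler_norm (- Hbar); rewrite normrN in h5.
    move: h1 h2 h3 h4 h5 e10; lra.
  have := superdiff_ineq (v t) (hsubdiff_moreau c0 bmin (x s)).
  have : `|L (x t) (v t) - L (x s + b (x s)) (v t)| <= e1.
    apply: Hdl; first exact: le_trans (norm_le_enorm _) (ltW vR).
    rewrite opprD addrA; apply: (le_lt_trans (ler_normB _ _)).
    have n1 : `|x t - x s| <= dl / 3.
      by apply: norm_le_bound => [|i]; [exact: ltW|exact: Hdel].
    by have := norm_le_enorm (b (x s)); have := bK (x s); move: n1 dl0; lra.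
  by rewrite ler_norml => /andP[? ?]; lra.
move=> /(_ Hpt); rewrite -/(action L r x v) => Hact.
have m1 := @moreau_env_le _ _ (fun x => - phi x) b c bmin (x 0).
have m2 := @moreau_env_ge _ _ (fun x => - phi x) b c c0 bmin K (x r) nlip K0.
apply: (@le_trans _ _ ((phi (x r))%:E + (m (x r) - m (x 0) - (Hbar + e1) * r
    - e / 3)%:E + e%:E)%E); last by rewrite leeD2r// leeD2l.
rewrite -!EFinD lee_fin; move: m1 m2; rewrite -/m; move: Kc e1r; lra.
Qed.

(** Per unit of time, [eps / 2] pays for evaluating [L] at [z + b kappa z] and [eps / 2] for the
    quadratic remainder; a last [eps] pays for the envelope gap. The velocity bound [R1] makes [del]
    independent of [r] and [y]. *)
Lemma scheme_estimate (b vv : R -> V -> V) (eps : R) :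
  is_min_selection phi b -> is_argmax_selection L b vv -> 0 < eps ->
  exists2 kappa0, 0 < kappa0 & forall kappa, 0 < kappa <= kappa0 ->
    exists2 del, 0 < del & forall r y ts, is_partition r ts ->
      fineness ts < del ->
      (scheme_cost L phi (vv kappa) r y ts <=
       (phi y - Hbar * r + (r + 1) * eps)%:E)%E.
Proof.
move=> bsel vsel eps0; have [_ _ _ Hsub] := visc.
have [K K0 lip] := solution_lipschitz.
have plip z w : phi (z + w) <= phi z + K * enorm w.
  by have := lip z w; rewrite ler_norml => /andP[_ +]; lra.
have [C HC] := periodic_bounded Lcont Lper 0.
have C0 : 0 <= C by apply: le_trans (HC 0 0 _); rewrite ?normr0.
(* With this slope, a velocity longer than [R1] does worse in the maximization than velocity 0,
   whose cost is at most [C]. *)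
have [R0 HR0] := Lsuper (2 * K + C + 1).
pose R1 := Num.max R0 1; have R11 : 1 <= R1 by rewrite le_max lexx orbT.
have eps20 : 0 < eps / 2 by rewrite divr_gt0.
have [dl dl0 Hdl] := periodic_unif_continuous Lcont Lper R1 eps20.
(* The first bound gives an envelope gap [2 * K ^+ 2 * kappa ^+ 2] of at most [eps], the second a
   displacement [2 * K * kappa ^+ 2] below [dl / 2]. The added 1 covers [K = 0], and [kappa <= 1]
   gives [kappa ^+ 2 <= q]. *)
pose q := Num.min (eps / (2 * K ^+ 2 + 1)) (dl / (4 * K + 1)).
have K20 := sqr_ge0 K.
have q10 : 0 < 2 * K ^+ 2 + 1 by lra.
have q20 : 0 < 4 * K + 1 by lra.
have q0 : 0 < q by rewrite lt_min !divr_gt0.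
have qe : 2 * K ^+ 2 * q <= eps.
  have : q <= eps / (2 * K ^+ 2 + 1) by rewrite ge_min lexx.
  by rewrite ler_pdivlMr//; lra.
have qd : 4 * K * q < dl.
  have : q <= dl / (4 * K + 1) by rewrite ge_min lexx orbT.
  by rewrite ler_pdivlMr//; lra.
exists (Num.min 1 q); first by rewrite lt_min ltr01.
move=> kappa /andP[k0]; rewrite le_min => /andP[k1 kq].
have k20 : 0 < kappa ^+ 2 by rewrite exprn_gt0.
have k2q : kappa ^+ 2 <= q by rewrite expr2; apply: le_trans kq; rewrite ler_piMr// ltW.
pose c := (2 * kappa ^+ 2)^-1.
have c0 : 0 < c by rewrite invr_gt0 mulr_gt0.
have ck : c * (2 * kappa ^+ 2) = 1 by rewrite mulVf// gt_eqF// mulr_gt0.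
have bmin z v : phi (z + b kappa z) + c * enorm2 (b kappa z) <=
    phi (z + v) + c * enorm2 v by rewrite !(mulrC c); exact: bsel.
have pE z : pfeed b kappa z = moreau_grad (b kappa) c z.
  rewrite /pfeed /moreau_grad /c scalerN scaleNr; congr (- (_ *: _)).
  by field; rewrite gt_eqF.
pose m := moreau_env phi (b kappa) c.
have bK z : c * enorm (b kappa z) <= K.
  exact: moreau_displacement_le c0 bmin _ z plip K0.
have bd z : enorm (b kappa z) < dl / 2.
  have := ler_wpM2r (ltW (mulr_gt0 (ltr0Sn R 1) k20)) (bK z).
  rewrite mulrAC ck mul1r => h1.
  by have := ler_wpM2l K0 k2q; lra.
have gK z : enorm (moreau_grad (b kappa) c z) <= 2 * K.
  by rewrite enorm_moreau_grad// -mulrA ler_pM2l.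
have vR z : enorm (vv kappa z) <= R1.
  rewrite leNgt; apply/negP => vR.
  have vR0 : R0 <= enorm (vv kappa z) by rewrite (le_trans _ (ltW vR))// le_max lexx.
  have := vsel kappa k0 z 0; rewrite -(scale0r (0 : V)) dotpZr mul0r sub0r scale0r.
  rewrite pE => h1; have h2 := HR0 (z + b kappa z) (vv kappa z) vR0.
  have h3 := dotp_le (- moreau_grad (b kappa) c z) (vv kappa z).
  rewrite enormN in h3.
  have h4 := ler_wpM2r (enorm_ge0 (vv kappa z)) (gK z).
  have := HC (z + b kappa z) 0; rewrite normr0 lexx => /(_ isT).
  rewrite ler_norml => /andP[_ h5].
  have v1 : 1 < enorm (vv kappa z) by exact: le_lt_trans vR.
  have h6 := ler_wpM2l C0 (ltW v1).
  by move: h1 h2 h3 h4 h5 h6 v1; lra.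
(* The supersolution inequality at [z + b kappa z], the supremum in [Ham] being attained at the
   feedback velocity. *)
have feed z : dotp (moreau_grad (b kappa) c z) (vv kappa z) +
    L (z + b kappa z) (vv kappa z) <= - Hbar.
  have := Hsub _ _ (hsubdiff_moreau c0 bmin z).
  have hle : (Ham L (z + b kappa z) (- moreau_grad (b kappa) c z) <=
      (dotp (- moreau_grad (b kappa) c z) (vv kappa z) -
       L (z + b kappa z) (vv kappa z))%:E)%E.
    apply: ge_ereal_sup => _ [w _ <-]; rewrite lee_fin -pE; exact: vsel.
  by move=> /le_trans /(_ hle); rewrite lee_fin dotpNl; lra.
(* Within one cell the motion stays below [dl / 2], and the remainder [c * R1 ^+ 2 * h ^+ 2] below
   [h * eps / 2]. *)
pose del := Num.min (dl / (2 * R1)) (eps / (2 * c * R1 ^+ 2)).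
have R10 : 0 < R1 by exact: lt_le_trans R11.
have del0 : 0 < del by rewrite lt_min !divr_gt0 ?mulr_gt0 ?exprn_gt0.
exists del => // r y ts Hts fin.
have -> : phi y - Hbar * r + (r + 1) * eps = phi y + r * (eps - Hbar) + eps by ring.
apply: (@scheme_cost_le R d (vv kappa) L m
  (fun z => L (z + b kappa z) (vv kappa z) + eps / 2) _ del) => //.
- move=> z t t0; rewrite lt_min => /andP[td _].
  have : `|L (z + t *: vv kappa z) (vv kappa z) -
      L (z + b kappa z) (vv kappa z)| <= eps / 2.
    apply: Hdl; first exact: le_trans (norm_le_enorm _) (vR z).
    rewrite opprD addrACA subrr add0r; apply: (le_lt_trans (ler_normB _ _)).
    have h1 := norm_le_enorm (b kappa z).
    have h2 := norm_le_enorm (t *: vv kappa z); rewrite enormZ ger0_norm// in h2.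
    have h3 := ler_wpM2l t0 (vR z).
    move: td; rewrite ltr_pdivlMr ?mulr_gt0// => td.
    by have := bd z; move: h1 h2 h3; lra.
  by rewrite ler_norml => /andP[_ ?]; lra.
- move=> z h h0; rewrite lt_min => /andP[_].
  rewrite ltr_pdivlMr ?mulr_gt0 ?exprn_gt0// => hd.
  have := moreau_env_step bmin z (h *: vv kappa z); rewrite -/m dotpZr enorm2Z => h1.
  have h2 := ler_wpM2l h0 (feed z).
  have h3 : enorm2 (vv kappa z) <= R1 ^+ 2.
    by rewrite -sqr_enorm lerXn2r ?nnegrE ?enorm_ge0// ltW.
  have h4 := ler_wpM2l (mulr_ge0 (mulr_ge0 h0 h0) (ltW c0)) h3.
  have h5 := ler_wpM2l h0 (ltW hd).
  by move: h1 h2 h4 h5; lra.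
- move=> z; rewrite (moreau_env_le bmin)/=.
  have := moreau_env_ge c0 bmin z plip K0; rewrite -/m.
  have -> : K ^+ 2 / c = 2 * K ^+ 2 * kappa ^+ 2.
    by rewrite /c invrK; ring.
  by have := ler_wpM2l K20 k2q; lra.
Qed.

(** Supplies a feedback for the Lax-Oleinik upper bound, whose statement mentions none. Superlinear
    growth makes [L z u + dotp p u] coercive in [u]. *)
Lemma exists_selections : exists b vv : R -> V -> V,
  is_min_selection phi b /\ is_argmax_selection L b vv.
Proof.
have [phic _ _ _] := visc; have bd := solution_bounded.
have /choice[b Hb] : forall kappa : R, exists b : V -> V, 0 < kappa ->
    forall x v : V, phi (x + b x) + enorm2 (b x) / (2 * kappa ^+ 2) <=
      phi (x + v) + enorm2 v / (2 * kappa ^+ 2).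
  move=> kappa; have [k0|k0] := ltP 0 kappa; last by exists (fun=> 0).
  have c0 : 0 < (2 * kappa ^+ 2)^-1 by rewrite invr_gt0 mulr_gt0 ?exprn_gt0.
  have [b Hb] := exists_moreau_argmin phic bd c0.
  by exists b => _ x v; have := Hb x v; rewrite !(mulrC _^-1).
have /choice[vv Hvv] : forall kx : R * V, exists u : V, forall w : V,
    L (kx.2 + b kx.1 kx.2) u + dotp (pfeed b kx.1 kx.2) u <=
    L (kx.2 + b kx.1 kx.2) w + dotp (pfeed b kx.1 kx.2) w.
  move=> [kappa x] /=; set z := x + _; set p := pfeed _ _ _.
  apply: (@exists_minimizer_coercive _ _ (fun u => L z u + dotp p u)).
    move=> u.
    have h1 : (fun u => L z u) @ u --> L z u.
      have zu : (fun u : V => (z, u)) @ u --> (z, u).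
        apply: (@cvg_pair V V V (nbhs u) (nbhs z) (nbhs u) _ _ _ (fun=> z) id).
          exact: cvg_cst.
        exact: cvg_id.
      exact: (continuous_comp zu (@Lcont (z, u))).
    exact: (@cvgD _ R^o _ (nbhs u) _ _ _ _ _ h1 (@continuous_dotp _ _ p u)).
  move=> A; have [R0 HR0] := Lsuper (enorm p + 1).
  (* Slope [enorm p + 1] leaves at least [enorm u >= A] after subtracting the linear term. *)
  exists (Num.max R0 A) => u; rewrite ge_max => /andP[uR uA].
  have := HR0 z u uR; have := normr_dotp_le p u.
  by rewrite ler_norml => /andP[? _]; lra.
exists b, (fun kappa x => vv (kappa, x)); split; first by move=> kappa k0; exact: Hb.
move=> kappa k0 x w; have := Hvv (kappa, x) w; rewrite /= !dotpNl; lra.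
Qed.

Lemma LaxOleinik_solution (r : R) (y : V) : 0 < r ->
  LaxOleinik L r phi y = (phi y - r * Hbar)%:E.
Proof.
move=> r0; apply/eqP; rewrite eq_le; apply/andP; split; last first.
  apply: le_ereal_inf_tmp => _ [[x v] /= [xv <-] <-].
  exact: action_ge.
apply/lee_addgt0Pr => e e0.
have [b [vv [bsel vsel]]] := exists_selections.
(* The scheme loses [r + 1] times its tolerance, hence exactly [e]. *)
have e'0 : 0 < e / (r + 1) by rewrite divr_gt0// addr_gt0.
have [kappa kappa0 H] := scheme_estimate bsel vsel e'0.
have [|del del0 Hdel] := H kappa; first by rewrite kappa0 lexx.
have [ts [Hts fin]] := exists_fine_partition r0 del0.
apply: ge_ereal_inf; exists (scheme_cost L phi (vv kappa) r y ts).
  exists (traj (vv kappa) y ts, ctrl (vv kappa) y ts) => //=.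
  exact: scheme_controlled_process.
apply: (le_trans (Hdel r y ts Hts fin)); rewrite -EFinD lee_fin.
by rewrite [(r + 1) * _]mulrC divfK ?(mulrC r) ?gt_eqF// addr_gt0.
Qed.

End Main.

Theorem theorem3 (R : realType) (d : nat)
  (L : 'rV[R]_d -> 'rV[R]_d -> R) (phi : 'rV[R]_d -> R) (Hbar : R) :
  continuous (fun z : 'rV[R]_d * 'rV[R]_d => L z.1 z.2) ->
  (forall v : 'rV[R]_d, Zperiodic (fun x => L x v)) ->
  (forall M : R, exists R0 : R, forall x v : 'rV[R]_d,
      R0 <= enorm v -> M * enorm v <= L x v) ->
  viscosity_solution L phi Hbar ->
  (forall r : R, 0 < r -> forall y : 'rV[R]_d,
      LaxOleinik L r phi y = (phi y - r * Hbar)%:E) /\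
  (forall b vv : R -> 'rV[R]_d -> 'rV[R]_d,
      (forall kappa, Zperiodic (b kappa)) ->
      (forall kappa, Zperiodic (vv kappa)) ->
      is_min_selection phi b ->
      is_argmax_selection L b vv ->
      forall eps : R, 0 < eps ->
      exists2 kappa0 : R, 0 < kappa0 &
        forall kappa : R, 0 < kappa <= kappa0 ->
        forall r : R, 0 < r -> forall y : 'rV[R]_d,
          (limsup_fineness r (scheme_cost L phi (vv kappa) r y)
           <= (phi y - Hbar * r + (r + 1) * eps)%:E)%E).
Proof.
move=> Lcont Lper Lsuper visc; split.
  by move=> r r0 y; exact: LaxOleinik_solution.
move=> b vv _ _ bsel vsel eps eps0.
have [k0 k00 H] := scheme_estimate Lcont Lper Lsuper visc bsel vsel eps0.
exists k0 => // kappa Hk r r0 y; have [del del0 Hdel] := H kappa Hk.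
(* The upper limit is an infimum over [del] of suprema, so one suitable [del] is enough. *)
apply: ge_ereal_inf; exists (ereal_sup [set scheme_cost L phi (vv kappa) r y ts |
    ts in [set ts | is_partition r ts /\ fineness ts < del]]).
  by exists del.
by apply: ge_ereal_sup => _ [ts [Hts fin] <-]; exact: Hdel.
Qed.
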